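(* Let $x,y,u,v$ be indeterminates and let the polynomials $P_n(x,y,u,v)$ ($n\ge 0$) be defined by the S-type continued fraction $$\sum_{n=0}^\infty P_n(x,y,u,v)\,t^n \;=\; \cfrac{1}{1-\cfrac{\alpha_1 t}{1-\cfrac{\alpha_2 t}{1-\cfrac{\alpha_3 t}{1-\cdots}}}}$$ with coefficients $\alpha_{2k-1}=x+(k-1)u$ and $\alpha_{2k}=y+(k-1)v$ for $k\ge 1$. Then for all $n\ge 0$ these polynomials have the combinatorial interpretations (a) $\displaystyle P_n(x,y,u,v)=\sum_{\sigma\in\mathfrak S_n} x^{\mathrm{arec}(\sigma)}\,y^{\mathrm{erec}(\sigma)}\,u^{\,n-\mathrm{exc}(\sigma)-\mathrm{arec}(\sigma)}\,v^{\,\mathrm{exc}(\sigma)-\mathrm{erec}(\sigma)}$ and (b) $\displaystyle P_n(x,y,u,v)=\sum_{\sigma\in\mathfrak S_n} x^{\mathrm{cyc}(\sigma)}\,y^{\mathrm{erec}(\sigma)}\,u^{\,n-\mathrm{exc}(\sigma)-\mathrm{cyc}(\sigma)}\,v^{\,\mathrm{exc}(\sigma)-\mathrm{erec}(\sigma)}.$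
   Context: $\mathfrak S_n$ is the set of permutations of $[n]=\{1,\dots,n\}$. Continued fractions are identities of formal power series in $t$. For $\sigma\in\mathfrak S_n$, an index $i\in[n]$ is: a record if $\sigma(j)<\sigma(i)$ for all $j<i$; an antirecord if $\sigma(j)>\sigma(i)$ for all $j>i$; an exclusive record if it is a record and not an antirecord; an excedance if $\sigma(i)>i$. We write $\mathrm{arec}(\sigma)$, $\mathrm{erec}(\sigma)$, $\mathrm{exc}(\sigma)$, $\mathrm{cyc}(\sigma)$ for the number of antirecords, exclusive records, excedances and cycles (fixed points included as cycles of length 1) of $\sigma$, respectively. (All exponents appearing are nonnegative.) *)

(* Defs.v *)
From HB Require Import structures.
From mathcomp Require Import all_boot all_order all_algebra all_fingroup.
From mathcomp Require Import mpoly.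

Set Implicit Arguments.
Unset Strict Implicit.
Unset Printing Implicit Defensive.

Import GRing.Theory.
Local Open Scope ring_scope.

(* A formal power series in t over R is the sequence of its coefficients. *)
Definition fps (R : Type) : Type := nat -> R.

Section FormalPowerSeries.

Variable R : comUnitRingType.
Implicit Types f g : fps R.

Definition fps1 : fps R := fun n => (n == 0%N)%:R.

Definition fps_sub f g : fps R := fun n => f n - g n.

Definition fps_mul f g : fps R := fun n => \sum_(i < n.+1) f i * g (n - i)%N.

(* The series (c t) * f. *)
Definition fps_ctmul (c : R) f : fps R :=
  fun n => if n is m.+1 then c * f m else 0.

(* The first n coefficients of 1 / f, computed from                           *)
(*   [f]_0 [1/f]_n = [n = 0] - \sum_(i < n) [f]_(n - i) [1/f]_i;              *)
(* this is meaningful when f 0 is a unit, see fps_mul_inv.                    *)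
Fixpoint fps_inv_seq f (n : nat) : seq R :=
  if n is m.+1 then
    let s := fps_inv_seq f m in
    rcons s ((f 0%N)^-1 * ((m == 0%N)%:R - \sum_(i < m) f (m - i)%N * s`_i))
  else [::].

Definition fps_inv f : fps R := fun n => (fps_inv_seq f n.+1)`_n.

Lemma size_fps_inv_seq f n : size (fps_inv_seq f n) = n.
Proof. by elim: n => //= n IHn; rewrite size_rcons IHn. Qed.

Lemma nth_fps_inv_seq f n i : (i < n)%N -> (fps_inv_seq f n)`_i = fps_inv f i.
Proof.
elim: n => // n IHn; rewrite ltnS leq_eqVlt => /predU1P[-> //|ltin].
by rewrite /= nth_rcons size_fps_inv_seq ltin IHn.
Qed.

Lemma fps_mul_inv f : f 0%N \is a GRing.unit -> fps_mul f (fps_inv f) =1 fps1.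
Proof.
move=> f0U n; rewrite /fps_mul big_ord_recl subn0.
rewrite {1}/fps_inv /= nth_rcons size_fps_inv_seq ltnn eqxx mulrA divrr // mul1r.
rewrite (reindex_inj rev_ord_inj) /=.
rewrite -[X in _ + X]opprK -[X in _ = X]addr0 /fps1 -addrA; congr (_ + _).
rewrite opprK addrC; apply/eqP; rewrite subr_eq0; apply/eqP/eq_bigr => i _.
rewrite nth_fps_inv_seq /bump /= ?add1n; last first.
  by rewrite -subn_gt0 subKn.
by rewrite subKn.
Qed.

(* The finite continued fraction with k levels                                *)
(*   1 / (1 - a_j t / (1 - a_(j+1) t / ( ... / (1 - a_(j+k-1) t)))).           *)
Fixpoint Sfrac_fin (a : nat -> R) (k j : nat) : fps R :=
  if k is k'.+1 then
    fps_inv (fps_sub fps1 (fps_ctmul (a j) (Sfrac_fin a k' j.+1)))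
  else fps1.

(* f is the infinite S-fraction with coefficients a_1, a_2, ... (a 0 is not   *)
(* used): its convergents tend to f in the topology of R[[t]], i.e. each      *)
(* coefficient is eventually constant, equal to that of f.                    *)
Definition is_Sfrac (a : nat -> R) f : Prop :=
  forall n, exists K, forall k, (K <= k)%N -> Sfrac_fin a k 1 n = f n.

Lemma eq_fps_inv f g n :
  (forall i, (i <= n)%N -> f i = g i) -> fps_inv f n = fps_inv g n.
Proof.
move=> fg; rewrite /fps_inv; congr (_`_n).
suff: forall m, (m <= n.+1)%N -> fps_inv_seq f m = fps_inv_seq g m by apply.
elim=> //= m IHm ltmn; rewrite IHm 1?ltnW // fg //; congr (rcons _ (_ * (_ - _))).
by apply: eq_bigr => i _; rewrite fg // (leq_trans (leq_subr _ _)).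
Qed.

Lemma Sfrac_fin_stable a n k l j :
  (n <= k)%N -> (n <= l)%N -> Sfrac_fin a k j n = Sfrac_fin a l j n.
Proof.
have inv0 c f : fps_inv (fps_sub fps1 (fps_ctmul c f)) 0%N = 1.
  by rewrite /fps_inv /= big_ord0 /fps_sub /fps1 /= !subr0 invr1 mulr1.
elim: k l n j => [|k IHk] [|l] n j //=.
- by rewrite leqn0 => /eqP-> _; rewrite inv0.
- by move=> _; rewrite leqn0 => /eqP->; rewrite inv0.
move=> lenk lenl; apply: eq_fps_inv => -[|i] // lein; rewrite /fps_sub /=.
by rewrite (IHk l) // -ltnS (leq_trans lein).
Qed.

Lemma Sfrac_exists (a : nat -> R) : exists f, is_Sfrac a f.
Proof.
exists (fun n => Sfrac_fin a n 1 n) => n; exists n => k lenk.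
exact: Sfrac_fin_stable.
Qed.

End FormalPowerSeries.

(* The set [n] is represented by 'I_n, with indices shifted down by one.      *)
Section PermutationStatistics.

Variable n : nat.
Implicit Types (s : 'S_n) (i : 'I_n).

Definition is_rec s i : bool := [forall j : 'I_n, (j < i)%N ==> (s j < s i)%N].

Definition is_arec s i : bool := [forall j : 'I_n, (i < j)%N ==> (s i < s j)%N].

Definition is_erec s i : bool := is_rec s i && ~~ is_arec s i.

Definition is_exc s i : bool := (i < s i)%N.

Definition arec s : nat := #|[set i | is_arec s i]|.
Definition erec s : nat := #|[set i | is_erec s i]|.
Definition exc s : nat := #|[set i | is_exc s i]|.

(* The orbits of s on all of 'I_n, so fixed points count as cycles.           *)
Definition cyc s : nat := #|porbits s|.

End PermutationStatistics.

(* Main.v *)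
Require Import Defs.
From HB Require Import structures.
From mathcomp Require Import all_boot all_order all_algebra all_fingroup.
From mathcomp Require Import mpoly.

Set Implicit Arguments.
Unset Strict Implicit.
Unset Printing Implicit Defensive.

Import GRing.Theory.
Local Open Scope ring_scope.

(** Both identities come from reading the diagram of a permutation s of [n]
along a staircase. The partial permutation of s in [p] x [q] (positions below
p, values below q) is revealed for (p, q) = (0,0), (0,1), (1,1), (1,2), ...,
(n,n), so the steps alternate between adding a value and adding a position.
Call a position open when its value is not yet revealed, and dually for
values. At level (i,i) there are as many open positions as open values, say k,
and the level is recorded as height 2k; at level (i,i+1) there are k open
positions and k+1 open values, recorded as height 2k+1. Each step leaves the
new item open (the height goes up by one) or matches it with one of the open
items of the other kind (the height goes down by one), so the heights form a
Dyck path of length 2n.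

A value i that is matched with an open position makes that position an
excedance, and the excedance is a record exactly when the position was the
first open one. So among the k choices one has weight y and k-1 have weight v:
a fall from height 2k weighs alpha_(2k). A position i that is matched with one
of the k+1 open values is not an excedance, and it is an antirecord exactly
when the value is the smallest open one; it closes a cycle exactly when the
value is the start of the path of i in the partial permutation. For either
statistic exactly one of the k+1 choices has weight x and the others have
weight u: a fall from height 2k+1 weighs alpha_(2k+1). Hence both (a) and (b)
equal the weighted number of Dyck paths of length 2n, which is the n-th
coefficient of the S-fraction (is_Sfrac_Dyck).

Partial permutations are not given a type of their own. They are the classes of
the relation agree p q on permutations, and the sum over a class of the weights
of the steps still to come is computed by descending induction on the level
(sum_agree_Dyck). A single lemma, sum_agree_step, treats the addition of a
value; it is applied to inverse permutations for the addition of a position.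
It takes as a parameter the distinguished choice, which is the only point where
antirecords (arec_special) and cycles (cycmax_special) differ: cycles are
counted by their greatest elements. *)

(** * Dyck paths and S-fractions *)

Section DyckPaths.

Variable R : comUnitRingType.
Implicit Types (f g : fps R) (a : nat -> R).

(** The paths have [r] steps and go from height [h] down to 0; a fall from
height [h] weighs [a h] and a rise weighs 1. *)
Fixpoint Dyck a (r h : nat) : R :=
  if r is r'.+1 then
    Dyck a r' h.+1 + (if h is h'.+1 then a h * Dyck a r' h' else 0)
  else (h == 0%N)%:R.

Lemma Dyck_lt a r h : (r < h)%N -> Dyck a r h = 0.
Proof.
elim: r h => [|r IHr] [|h] //= ltrh.
by rewrite !IHr ?mulr0 ?addr0 // ltnW // ltnW.
Qed.

(** Truncation to polynomials gives access to the ring laws of [{poly R}]. *)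
Lemma fps_mulE f g N n : (n < N)%N ->
  fps_mul f g n = ((\poly_(i < N) f i) * (\poly_(i < N) g i))`_n.
Proof.
move=> ltnN; rewrite coefM; apply: eq_bigr => i _; rewrite !coef_poly.
by rewrite (leq_ltn_trans _ ltnN) ?(leq_ltn_trans (leq_subr _ _) ltnN) // -ltnS.
Qed.

Lemma fps_mulC f g : fps_mul f g =1 fps_mul g f.
Proof. by move=> n; rewrite !(fps_mulE _ _ (ltnSn n)) mulrC. Qed.

Lemma fps_mulA f g k : fps_mul f (fps_mul g k) =1 fps_mul (fps_mul f g) k.
Proof.
move=> n; set T := fun f => \poly_(i < n.+1) f i.
transitivity ((T f * (T g * T k))`_n).
  rewrite coefM; apply: eq_bigr => i _.
  by rewrite coef_poly ltn_ord -fps_mulE // ltnS leq_subr.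
rewrite mulrA coefM; apply: eq_bigr => i _.
by rewrite coef_poly ltnS leq_subr -fps_mulE.
Qed.

Lemma eq_fps_mul f f' g g' :
  f =1 f' -> g =1 g' -> fps_mul f g =1 fps_mul f' g'.
Proof. by move=> ff gg n; apply: eq_bigr => i _; rewrite ff gg. Qed.

(** The continued fraction that starts at [a j]. A convergent with [n] levels
is exact up to the coefficient of degree [n]. *)
Definition Sfrac a (j : nat) : fps R := fun n => Sfrac_fin a n j n.

(** This is the equation G_j = 1 + a_j t G_(j+1) G_j, that is,
G_j = 1 / (1 - a_j t G_(j+1)). *)
Lemma Sfrac_rec a j n :
  Sfrac a j n =
    if n is m.+1 then a j * fps_mul (Sfrac a j.+1) (Sfrac a j) m else 1.
Proof.
set f := fps_sub (fps1 R) (fps_ctmul (a j) (Sfrac a j.+1)).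
have f0 : f 0%N = 1 by rewrite /f /fps_sub /fps1 /= subr0.
have inv_f i : Sfrac a j i = fps_inv f i.
  rewrite /Sfrac (Sfrac_fin_stable _ _ (leqnn i) (leqnSn i)) /=.
  apply: eq_fps_inv => -[|k] // leki; rewrite /f /fps_sub /= /Sfrac.
  by rewrite (Sfrac_fin_stable _ _ (ltnW leki) (leqnn k)).
have := @fps_mul_inv _ f; rewrite f0 unitr1 => /(_ isT n).
rewrite /fps_mul big_ord_recl subn0 f0 mul1r -inv_f /fps1.
case: n => [|n] /=; first by rewrite big_ord0 addr0.
move/eqP; rewrite addr_eq0 => /eqP->.
rewrite mulr_sumr -sumrN; apply: eq_bigr => i _.
by rewrite /bump /= add1n subSS -inv_f /f /fps_sub /fps1 /= sub0r mulNr opprK mulrA.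
Qed.

(** The product G_1 ... G_(h+1): cutting a path from height [h] to 0 at its
first visits to the heights [h - 1], ..., 0 gives one factor per height. *)
Fixpoint Sfrac_prod a (h : nat) : fps R :=
  if h is h'.+1 then fps_mul (Sfrac_prod a h') (Sfrac a h.+1) else Sfrac a 1.

(** Multiply G_(h+2) = 1 + a_(h+2) t G_(h+3) G_(h+2) by G_1 ... G_(h+1). *)
Lemma Sfrac_prod_rec a h m :
  Sfrac_prod a h.+1 m = Sfrac_prod a h m +
    (if m is m'.+1 then a h.+2 * Sfrac_prod a h.+2 m' else 0).
Proof.
rewrite /= {1}/fps_mul big_ord_recr /= subnn (Sfrac_rec _ _ 0) mulr1 addrC.
congr (_ + _); case: m => [|m]; first by rewrite big_ord0.
have /(_ m)<-: fps_mul (Sfrac_prod a h) (fps_mul (Sfrac a h.+3) (Sfrac a h.+2))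
    =1 fps_mul (fps_mul (Sfrac_prod a h) (Sfrac a h.+2)) (Sfrac a h.+3).
  by move=> k; rewrite -fps_mulA; apply: eq_fps_mul => // i; rewrite fps_mulC.
rewrite mulr_sumr; apply: eq_bigr => i _.
by rewrite subSn -1?ltnS // (Sfrac_rec a h.+2 (m - i).+1) mulrCA.
Qed.

(** Both sides satisfy the same recursion on the first step, by
[Sfrac_prod_rec]. The product of coefficients accounts for the [h] falls that
no rise of the path compensates; [m] is the number of rises. *)
Lemma Dyck_Sfrac_prod a m h :
  Dyck a (h + m.*2) h = (\prod_(1 <= i < h.+1) a i) * Sfrac_prod a h m.
Proof.
move Dr : (h + m.*2)%N => r.
elim: r h m Dr => [|r IHr] h m Dr.
  have [-> ->] : h = 0%N /\ m = 0%N.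
    by case: h m Dr => [|h] [|m].
  by rewrite big_nil /= Sfrac_rec mulr1.
rewrite /=; case: h Dr => [|h] Dr.
  case: m Dr => // m; rewrite add0n doubleS => -[Dr].
  rewrite (IHr 1%N m) ?add1n // big_nat1 big_nil addr0 mul1r.
  rewrite [RHS](Sfrac_rec a 1 m.+1); congr (_ * _); exact: fps_mulC.
rewrite Sfrac_prod_rec mulrDr addrC; congr (_ + _).
  rewrite (IHr h m); last by case: Dr.
  by rewrite [in RHS]big_nat_recr //= mulrCA mulrA.
case: m Dr => [|m] Dr.
  by rewrite mulr0 Dyck_lt //; case: Dr => <-; rewrite addn0.
rewrite (IHr h.+2 m); last by case: Dr => <-; rewrite doubleS !addnS !addSn.
by rewrite [in LHS]big_nat_recr //= mulrA.
Qed.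

Lemma is_Sfrac_Dyck a f n : is_Sfrac a f -> f n = Dyck a n.*2 0.
Proof.
move=> /(_ n)[K /(_ (maxn K n))]; rewrite leq_maxl => /(_ isT) <-.
have := Dyck_Sfrac_prod a n 0; rewrite add0n big_nil mul1r => -> /=.
by apply: Sfrac_fin_stable; rewrite ?leq_maxr.
Qed.

End DyckPaths.

(** * Permutations known on a rectangle *)

Section Sweep.

Variable n : nat.
Implicit Types (s t : 'S_n) (i j : 'I_n) (p q : nat).

Definition agree p q s t : bool :=
  [forall j : 'I_n, forall v : 'I_n,
     (j < p)%N && (v < q)%N ==> ((s j == v) == (t j == v))].

Definition opens p q s : {set 'I_n} := [set j : 'I_n | (j < p)%N && (q <= s j)%N].

Lemma agreeP p q s t :
  reflect (forall j v : 'I_n, (j < p)%N -> (v < q)%N -> (s j == v) = (t j == v))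
          (agree p q s t).
Proof.
apply: (iffP forallP) => [H j v jp vq|H j].
  by have /forallP/(_ v) := H j; rewrite jp vq => /eqP.
by apply/forallP => v; apply/implyP => /andP[jp vq]; rewrite H.
Qed.

Lemma agreeV p q s t : agree q p s^-1 t^-1 = agree p q s t.
Proof.
have V s' (j v : 'I_n) : (s'^-1%g v == j) = (s' j == v).
  by rewrite -(inj_eq (@perm_inj _ s')) permKV eq_sym.
by apply/agreeP/agreeP => H j v jp vq; [rewrite -(V s) -(V t) | rewrite (V s) (V t)]; apply: H.
Qed.

Lemma agree_refl p q s : agree p q s s.
Proof. by apply/agreeP. Qed.

Lemma agree_eql p q s s' t : agree p q s s' -> agree p q s' t = agree p q s t.
Proof. by move/agreeP=> H; apply/agreeP/agreeP => H' j v jp vq; rewrite -?H' ?H. Qed.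

Lemma agree_opens p q s t : agree p q s t -> opens p q s = opens p q t.
Proof.
move=> /agreeP H; apply/setP => j; rewrite !inE; case: ltnP => //= jp.
rewrite [LHS]leqNgt [RHS]leqNgt; congr (~~ _); apply/idP/idP => lt.
  by have := H j (s j) jp lt; rewrite eqxx => /esym/eqP->.
by have := H j (t j) jp lt; rewrite eqxx => /eqP->.
Qed.

(** When the value of [j] is not below [q], composing [s] with a transposition
moves the value [q] to [j] without touching the partial permutation. The result
represents the class reached from that of [s] when [q] is matched with [j] (if
j < p) or left open (if p <= j). *)
Definition extend s j (q : 'I_n) : 'S_n := (tperm j (s^-1 q) * s)%g.

Lemma extend_eq s j (q : 'I_n) k : (extend s j q k == q) = (k == j).
Proof.
rewrite permM -(inj_eq (@perm_inj _ s^-1)) permK.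
by rewrite (canF_eq (@tpermK _ _ _)) tpermR.
Qed.

Lemma extend_lt s j (q v : 'I_n) k :
  (q <= s j)%N -> (v < q)%N -> (extend s j q k == v) = (s k == v).
Proof.
move=> qj vq; rewrite permM; case: tpermP => // ->; rewrite ?permKV.
  have /negPf->: q != v by rewrite neq_ltn vq orbT.
  by apply/esym/negP => /eqP sv; rewrite sv leqNgt vq in qj.
have /negPf->: s j != v by apply/eqP => sv; rewrite sv leqNgt vq in qj.
by rewrite eq_sym -val_eqE /= ltn_eqF.
Qed.

(** A class at level (p, q+1) is a class at level (p, q) together with the
decision taken for the value [q]. *)
Lemma agree_extend p (q : 'I_n) s t j : (q <= s j)%N ->
  agree p q.+1 (extend s j q) t =
  agree p q s t && (if (j < p)%N then t j == q else (p <= t^-1%g q)%N).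
Proof.
move=> qj; apply/agreeP/andP => [H|[/agreeP H E] k v kp].
  split; first by apply/agreeP => k v kp vq; rewrite -(extend_lt k qj vq) H // ltnS ltnW.
  case: ltnP => jp; first by rewrite -H // extend_eq.
  rewrite leqNgt; apply/negP => tp; have := H _ q tp (ltnSn q).
  by rewrite extend_eq permKV eqxx => /eqP tj; rewrite tj ltnNge jp in tp.
rewrite ltnS leq_eqVlt => /orP[/eqP/val_inj->|vq]; last by rewrite extend_lt // H.
rewrite extend_eq; case: ltnP E => jp; first by move/eqP <-; rewrite (inj_eq perm_inj).
move=> tp; have /negPf->: k != j by rewrite neq_ltn (leq_trans kp jp).
by apply/esym/negP => /eqP tk; rewrite -tk permK leqNgt kp in tp.
Qed.

Lemma opens_extend p (q : 'I_n) s j : (q <= s j)%N ->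
  opens p q.+1 (extend s j q) = opens p q s :\ j.
Proof.
move=> qj; apply/setP => k; rewrite !inE.
have -> : (q < extend s j q k)%N = (k != j) && (q <= extend s j q k)%N.
  by rewrite ltn_neqAle eq_sym val_eqE extend_eq.
rewrite andbCA; congr (_ && (_ && _)).
rewrite [LHS]leqNgt [RHS]leqNgt; congr (~~ _); apply/idP/idP => lt.
  by have := extend_lt k qj lt; rewrite eqxx => /esym/eqP->.
by have := extend_lt k qj lt; rewrite eqxx => /eqP->.
Qed.

Lemma card_lt_perm t r : (r <= n)%N -> #|[set j | (t j < r)%N]| = r.
Proof.
move=> rn; rewrite -sum1_card (reindex_inj (@perm_inj _ t^-1)) /=.
rewrite (eq_bigl (fun j : 'I_n => (j < r)%N)) => [|j]; last by rewrite inE permKV.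
by rewrite (big_ord_narrow rn) sum1_card card_ord.
Qed.

(** The matched positions of [p] x [q] are as many as its matched values. *)
Lemma card_opensV p q s : (p <= n)%N -> (q <= n)%N ->
  (#|opens p q s| + q = #|opens q p s^-1| + p)%N.
Proof.
have split p' q' s' : (p' <= n)%N ->
    (#|opens p' q' s'| + #|[set j : 'I_n | (j < p') && (s' j < q')]| = p')%N.
  move=> pn; rewrite -[RHS](card_lt_perm 1 pn) -[RHS](cardsID [set j | (q' <= s' j)%N]).
  by congr (_ + _)%N; apply: eq_card => j; rewrite !inE perm1 -?ltnNge // andbC.
move=> pn qn; have := split p q s pn; have := split q p s^-1%g qn.
set c1 := #|[set j : 'I_n | (j < q) && (s^-1%g j < p)]%N|.
set c2 := #|[set j : 'I_n | (j < p) && (s j < q)]%N|.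
suff -> : c1 = c2 
  by move=> Eq Ep; apply: (@addIn c2); rewrite addnAC Ep addnAC Eq addnC.
rewrite /c1 -(card_imset _ (@perm_inj _ s^-1)); apply: eq_card => j.
rewrite inE; apply/imsetP/andP => [[k]|[jp sq]].
  by rewrite inE => /andP[? ?] ->; rewrite permKV.
by exists (s j); rewrite ?inE permK ?jp ?sq.
Qed.

(** * Revealing one more value *)

Section Step.

Variables (R : comUnitRingType) (a b : R).

(** The class of [s] at level (p, q) splits according to the decision taken for
the value [q]: left open, or matched with one of the open positions. All the
classes obtained in the second case have one open position less, and exactly
one of them, for the position [d], carries the weight [a]. The class in which
[q] is left open is empty when no position from p on has a value from q on;
then all the n - q values not yet revealed belong to open positions, and the
hypothesis [Phi (n - q) = 0] makes the formula true in this case as well. *)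
Lemma sum_agree_step p (q : 'I_n) s (spec : pred 'S_n) (F : 'S_n -> R)
    (Phi : nat -> R) :
  (forall t, \sum_(r | agree p q.+1 t r) F r = Phi #|opens p q.+1 t|) ->
  Phi (n - q)%N = 0 ->
  (opens p q s != set0 -> exists2 d, d \in opens p q s &
     forall t, agree p q s t -> (t^-1%g q < p)%N -> spec t = (t^-1%g q == d)) ->
  \sum_(t | agree p q s t)
     (if (t^-1%g q < p)%N then if spec t then a else b else 1) * F t =
  Phi #|opens p q s| +
    (if #|opens p q s| is k.+1 then (a + k%:R * b) * Phi k else 0).
Proof.
move=> PhiE Phi0 specE.
rewrite (bigID (fun t => p <= t^-1%g q)%N) /=; congr (_ + _).
  transitivity (\sum_(t | agree p q s t && (p <= t^-1%g q)%N) F t).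
    by apply: eq_bigr => t /andP[_]; rewrite leqNgt => /negPf->; rewrite mul1r.
  (* The part of the sum in which q is left open. *)
  have [t0 /andP[st0 pt0] | no_t] := pickP (fun t => agree p q s t && (p <= t^-1%g q)%N).
    have extt0 : extend t0 (t0^-1%g q) q = t0 by rewrite /extend tperm1 mul1g.
    have q0 : (q <= t0 (t0^-1%g q))%N by rewrite permKV.
    rewrite (agree_opens st0).
    have := opens_extend p q0; rewrite extt0 => opens0.
    have -> : opens p q t0 = opens p q.+1 t0.
      rewrite opens0; apply/setP => k; rewrite !inE.
      by case: eqP => //= ->; rewrite ltnNge pt0.
    rewrite -PhiE; apply: eq_bigl => t.
    have := agree_extend p t q0; rewrite extt0 => ->; rewrite ltnNge pt0 /=.
    by congr (_ && _); rewrite (agree_eql _ st0).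
  have opensE : opens p q s = opens n q s.
    apply/setP => j; rewrite !inE ltn_ord; case: ltnP => //= pj.
    apply/esym/negbTE/negP => qj; have := no_t (extend s j q).
    have := agree_extend p (extend s j q) qj.
    by rewrite agree_refl ltnNge pj /= => <-.
  rewrite big_pred0 ?Phi0 // opensE.
  have := card_opensV s (leqnn n) (ltnW (ltn_ord q)).
  have -> : opens q n s^-1 = set0.
    by apply/setP => j; rewrite !inE [(n <= _)%N]leqNgt !ltn_ord andbF.
  by rewrite cards0 add0n => /(canRL (addnK _))->; rewrite Phi0.
(* The part in which q is matched, split by the position of q. *)
rewrite (partition_big (fun t => t^-1%g q) (fun j => j \in opens p q s)) /=; last first.
  move=> t /andP[st]; rewrite (agree_opens st) inE -ltnNge permKV leqnn.
  by rewrite andbT.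
transitivity (\sum_(j in opens p q s) \sum_(t | agree p q.+1 (extend s j q) t)
                (if spec t then a else b) * F t).
  apply: eq_bigr => j; rewrite inE => /andP[jp qj].
  apply: eq_big => t.
    rewrite agree_extend // jp -ltnNge -andbA; congr (_ && _).
    rewrite -(inj_eq (@perm_inj _ t)) permKV eq_sym andb_idl // => /eqP <-.
    by rewrite permK.
  by case/andP=> /andP[_]; rewrite -ltnNge => ->.
case O0: (opens p q s != set0); last first.
  by move/eqP: O0 => ->; rewrite big_set0 cards0.
have [d dO dE] := specE O0.
have cO := cardsD1 d (opens p q s); rewrite dO add1n in cO.
rewrite cO.
transitivity (\sum_(j in opens p q s)
    (if j == d then a else b) * Phi #|opens p q s :\ d|).
  apply: eq_bigr => j jO.
  have /andP[jp qj] : (j < p)%N && (q <= s j)%N by rewrite inE in jO.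
  have -> : #|opens p q s :\ d| = #|opens p q s :\ j|.
    by apply: succn_inj; rewrite -cO (cardsD1 j) jO.
  rewrite -opens_extend // -PhiE mulr_sumr; apply: eq_bigr => t.
  rewrite agree_extend // jp => /andP[st /eqP tj].
  have jE : t^-1%g q = j by rewrite -tj permK.
  by rewrite dE // jE.
rewrite -mulr_suml (bigD1 d) //= eqxx; congr ((_ + _) * _).
rewrite (eq_bigr (fun=> b)) => [|j /andP[_ /negPf->//]].
rewrite sumr_const mulr_natl; congr (_ *+ _).
by apply: eq_card => j; rewrite [LHS]unfold_in !inE andbC.
Qed.

End Step.

(** * The distinguished choices *)

(** The position of [q] is a record when all the positions before it have values
below [q], that is, when none of them is open. *)
Lemma rec_special p (q : 'I_n) s : opens p q s != set0 ->
  exists2 d, d \in opens p q s &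
    forall t, agree p q s t -> (t^-1%g q < p)%N ->
      is_rec t (t^-1%g q) = (t^-1%g q == d).
Proof.
case/set0Pn=> j0 j0O.
have [d dO dmin] := @arg_minnP _ j0 (fun j => j \in opens p q s) val j0O.
exists d => //.
move=> t st.
rewrite (agree_opens st) in dO dmin.
have /andP[dp qd] : (d < p)%N && (q <= t d)%N by have := dO; rewrite inE.
set j := t^-1%g q => jp; have tj : t j = q by rewrite permKV.
apply/forallP/eqP => [H | jd k].
  have jO : j \in opens p q t by rewrite inE jp tj leqnn.
  apply/eqP; rewrite -val_eqE eqn_leq dmin // andbT leqNgt; apply/negP => dj.
  by have := H d; rewrite dj tj /= ltnNge qd.
apply/implyP => kj; rewrite tj ltnNge; apply/negP => qk.
have := dmin k; rewrite inE (ltn_trans kj jp) qk => /(_ isT).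
by rewrite /= -jd leqNgt kj.
Qed.

Definition cycmax i t : bool := [forall j in porbit t i, (j <= i)%N].

Lemma cycmaxV i t : cycmax i t^-1 = cycmax i t.
Proof. by rewrite /cycmax porbitV. Qed.

(** Let [d] be the first of the iterates i, s i, s (s i), ... whose image is at
least [i]; the iterates between [i] and [d] are below [i]. This path lies in the revealed part, so it
is common to all [t] that agree with [s], and [i] is the greatest element of
its [t]-cycle exactly when [t] sends [d] back to [i]. This is the choice that
closes the path; here [s] and [t] are the inverses of the permutations to which
a position is added, whence the rectangle [i+1] x [i]. *)
Lemma cycmax_special (i : 'I_n) s :
  exists2 d, d \in opens i.+1 i s &
    forall t, agree i.+1 i s t -> (t^-1%g i < i.+1)%N ->
      cycmax i t = (t^-1%g i == d).
Proof.
(* Such a d exists because the iterates come back to i. *)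
have ret : exists r, (i <= (s ^+ r.+1)%g i)%N.
  by exists (#[s]%g.-1); rewrite prednK ?order_gt0 // expg_order perm1.
case: (ex_minnP ret) => r ir rmin; exists ((s ^+ r)%g i).
  rewrite inE -permM -expgSr ir andbT ltnS.
  case: r {ir} rmin => [|r] rmin; first by rewrite expg0 perm1.
  by rewrite ltnW // ltnNge; apply/negP => /rmin; rewrite ltnn.
move=> t st ti.
have low k : (k < r)%N -> ((s ^+ k.+1)%g i < i)%N.
  by rewrite ltnNge => kr; rewrite ltnNge; apply: contra kr => /rmin.
have le k : (k <= r)%N -> ((s ^+ k)%g i <= i)%N.
  by case: k => [|k] kr; [rewrite expg0 perm1 | rewrite ltnW ?low].
have same k : (k <= r)%N -> (t ^+ k)%g i = (s ^+ k)%g i.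
  elim: k => [|k IHk] kr; first by rewrite !expg0.
  rewrite expgSr permM IHk 1?ltnW //; apply/eqP.
  have /agreeP <- := st; last exact: low.
    by rewrite expgSr permM.
  by rewrite ltnS le // ltnW.
have tO : (s ^+ r)%g i \in opens i.+1 i t.
  by rewrite -(agree_opens st) inE -permM -expgSr ir ltnS le.
apply/forall_inP/eqP => [H | tE j /porbitP[k ->]].
  have := H _ (mem_porbit t r.+1 i); rewrite expgSr permM same // => lti.
  move: tO; rewrite inE => /andP[_ gei].
  have {}tO : t ((s ^+ r)%g i) = i by apply: val_inj; apply/eqP; rewrite eqn_leq lti.
  by rewrite -[in LHS]tO permK.
have [k' k'r ->] : exists2 k', (k' <= r)%N & (t ^+ k)%g i = (t ^+ k')%g i.
  elim: k => [|k [k' k'r IHk]]; first by exists 0%N.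
  rewrite expgSr permM IHk; case: (ltngtP k' r) k'r => // k'r _.
    by exists k'.+1 => //; rewrite expgSr permM.
  by exists 0%N; rewrite // k'r same // -tE permKV expg0 perm1.
by rewrite same ?le.
Qed.

Lemma card_cycmax t : #|[set i | cycmax i t]| = cyc t.
Proof.
rewrite -(card_in_imset (f := porbit t)) => [|i j]; last first.
  rewrite !inE => /forall_inP Hi /forall_inP Hj E; apply/val_inj/eqP.
  by rewrite eqn_leq Hj ?Hi // -?E ?porbit_id // E porbit_id.
apply: eq_card => O; apply/imsetP/imsetP => -[i _ ->]; first by exists i.
have [j ji jmax] := @arg_maxnP _ i (fun k => k \in porbit t i) val (porbit_id t i).
have E : porbit t i = porbit t j by apply/eqP; rewrite eq_porbit_mem porbit_sym.
exists j => //; rewrite inE; apply/forall_inP => k; rewrite -E; exact: jmax.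
Qed.

(** The values smaller than [t i] are all taken at positions before [i], so
there are at most [i] of them. *)
Lemma arec_le t i : is_arec t i -> (t i <= i)%N.
Proof.
move=> /forallP H; rewrite -ltnS -(card_lt_perm t (ltn_ord (t i))).
rewrite -[X in (_ <= X)%N](card_lt_perm 1 (ltn_ord i)); apply: subset_leq_card.
apply/subsetP => j; rewrite !inE perm1 !ltnS => tji; rewrite leqNgt; apply/negP => ij.
by have := H j; rewrite ij /= ltnNge tji.
Qed.

(** A record at [i] with t i <= i is preceded by [i] smaller values; these are
then all the values below [t i], and [i] is an antirecord. *)
Lemma erecE t i : is_erec t i = is_exc t i && is_rec t i.
Proof.
rewrite /is_erec andbC /is_exc; case: (boolP (is_rec t i)); rewrite ?andbF //.
move=> /forallP H; rewrite !andbT; apply/idP/idP; last first.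
  by apply: contraL => /arec_le; rewrite leqNgt.
rewrite negb_forall => /existsP[k]; rewrite negb_imply -leqNgt => /andP[ik tki].
rewrite ltnNge; apply/negP => tii.
have sub : [set j | ((1 : 'S_n)%g j < i)%N] \subset [set j | (t j < t i)%N].
  by apply/subsetP => j; rewrite !inE perm1 => ji; have := H j; rewrite ji.
have /eqP E : [set j | ((1 : 'S_n)%g j < i)%N] == [set j | (t j < t i)%N].
  by rewrite eqEcard sub !card_lt_perm // ltnW.
have : k \in [set j | (t j < t i)%N].
  rewrite inE ltn_neqAle tki andbT val_eqE (inj_eq perm_inj).
  by rewrite neq_ltn ik orbT.
by rewrite -E inE perm1 ltnNge ltnW.
Qed.

Lemma is_recV t i : is_rec t^-1 (t i) = is_arec t i.
Proof.
apply/forallP/forallP => H k; apply/implyP => lt; rewrite ltnNge leq_eqVlt.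
  apply/norP; split; first by rewrite val_eqE (inj_eq perm_inj) neq_ltn lt orbT.
  by apply/negP => tki; have := H (t k); rewrite tki !permK /= ltnNge ltnW.
rewrite permK; apply/norP; split.
  by apply/eqP => /val_inj ik; rewrite ik permKV ltnn in lt.
by apply/negP => ik; have := H (t^-1%g k); rewrite ik permKV /= ltnNge ltnW.
Qed.

Lemma arec_special i s : opens i.+1 i s != set0 ->
  exists2 d, d \in opens i.+1 i s &
    forall t, agree i.+1 i s t -> (t^-1%g i < i.+1)%N ->
      is_arec t^-1 i = (t^-1%g i == d).
Proof.
case/rec_special => d dO dE; exists d => // t st ti.
by rewrite -is_recV invgK dE.
Qed.

(** * Summing over all permutations *)

Section Weights.

Variables (R : comUnitRingType) (x y u v : R) (a : nat -> R).
Hypothesis a_odd : forall k, a k.*2.+1 = x + k%:R * u.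
Hypothesis a_even : forall k, a k.*2.+2 = y + k%:R * v.

(** [spec i t] says that the position [i] receives the distinguished one of the
values open to it. *)
Variable spec : 'I_n -> pred 'S_n.
Hypothesis spec_special : forall i s, opens i.+1 i s != set0 ->
  exists2 d, d \in opens i.+1 i s &
    forall t, agree i.+1 i s t -> (t^-1%g i < i.+1)%N ->
      spec i t^-1%g = (t^-1%g i == d).

Definition value_weight (q : 'I_n) t : R :=
  if (t^-1%g q < q)%N then if is_rec t (t^-1%g q) then y else v else 1.

Definition position_weight i t : R :=
  if (t i < i.+1)%N then if spec i t then x else u else 1.

(** Two steps of the staircase, from (i, i) to (i, i+1) and then to (i+1, i+1),
each an instance of [sum_agree_step]; the second one is read on inverse
permutations. The vanishing hypothesis of that lemma is [Dyck_lt]. *)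
Lemma sum_agree_Dyck (m i : nat) s : (i + m = n)%N ->
  \sum_(t | agree i i s t)
     \prod_(j : 'I_n | (i <= j)%N) (value_weight j t * position_weight j t) =
  Dyck a m.*2 #|opens i i s|.*2.
Proof.
elim: m i s => [|m IHm] i s im.
  rewrite addn0 in im; rewrite im.
  rewrite (_ : opens n n s = set0) ?cards0; last first.
    by apply/setP => j; rewrite !inE [(n <= _)%N]leqNgt !ltn_ord andbF.
  rewrite (big_pred1 s) => [|t]; last first.
    apply/agreeP/eqP => [H|-> //]; apply/permP => j.
    by have := H j (s j) (ltn_ord _) (ltn_ord _); rewrite eqxx => /esym/eqP.
  by rewrite big_pred0 // => j; rewrite leqNgt ltn_ord.
have ilt : (i < n)%N by rewrite -im addnS ltnS leq_addr.
pose q := Ordinal ilt.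
have nbi : (n - q)%N = m.+1 by apply: (@addnI i); rewrite subnKC // ltnW.
pose W t := \prod_(j : 'I_n | (i.+1 <= j)%N)
  (value_weight j t * position_weight j t).
transitivity (\sum_(t | agree i q s t)
    (if (t^-1%g q < i)%N then if is_rec t (t^-1%g q) then y else v else 1) *
    (position_weight q t * W t)).
  apply: eq_bigr => t _; rewrite (bigD1 q) //= -mulrA; congr (_ * (_ * _)).
  by apply: eq_bigl => j; rewrite ltn_neqAle andbC eq_sym -val_eqE.
rewrite (@sum_agree_step _ y v i q s (fun t => is_rec t (t^-1%g q)) _
  (fun k => Dyck a m.*2.+1 k.*2.+1)); first 1 last.
- move=> t; rewrite (reindex_inj invg_inj) /=.
  transitivity (\sum_(r | agree i.+1 q t^-1 r)
      (if (r^-1%g q < i.+1)%N then if spec q r^-1%g then x else u else 1) *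
      W r^-1%g).
    by apply: eq_big => [r|r _ //]; rewrite -agreeV invgK.
  have cO : #|opens i.+1 i t^-1| = #|opens i i.+1 t|.+1.
    have := card_opensV t (ltnW ilt) ilt; rewrite addnS -addSn.
    by move/addIn.
  rewrite (@sum_agree_step _ x u i.+1 q t^-1 (fun r => spec q r^-1%g) _
    (fun k => Dyck a m.*2 k.*2)) ?cO /=.
  + by rewrite a_odd.
  + move=> r; transitivity (\sum_(r' | agree i.+1 i.+1 r^-1 r') W r').
      rewrite [RHS](reindex_inj invg_inj).
      by apply: eq_bigl => r'; rewrite agreeV.
    rewrite IHm ?addSnnS //; congr (Dyck _ _ _.*2); apply: (@addIn i.+1).
    exact/esym/card_opensV.
  + by rewrite nbi; apply: Dyck_lt; rewrite doubleS.
  + exact: (spec_special (i := q)).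
- by rewrite nbi; apply: Dyck_lt; rewrite doubleS.
- exact: rec_special.
- by case: #|_| => [|k] /=; rewrite ?a_even.
Qed.

(** At level (0, 0) all permutations agree. *)
Lemma sum_weights_Dyck :
  \sum_t \prod_j (value_weight j t * position_weight j t) = Dyck a n.*2 0.
Proof.
have opens0 : opens 0 0 (1 : 'S_n) = set0 by apply/setP => j; rewrite !inE.
rewrite -[0%N in RHS]/(0.*2) -(cards0 'I_n) -opens0 -sum_agree_Dyck //.
by apply: eq_big => // t; apply/esym/agreeP.
Qed.

Lemma prod_two_weights (A B : pred 'I_n) (b c : R) : (forall j, B j -> A j) ->
  \prod_j (if A j then if B j then b else c else 1) =
  b ^+ #|[set j | B j]| * c ^+ (#|[set j | A j]| - #|[set j | B j]|).
Proof.
move=> BA; rewrite -big_mkcond (bigID B) /=; congr (_ * _).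
  rewrite -prodr_const; apply: eq_big => j; last by case/andP=> _ ->.
  by rewrite inE andb_idl //; apply: BA.
have -> : (#|[set j | A j]| - #|[set j | B j]|)%N = #|[set j | A j] :\: [set j | B j]|.
  rewrite cardsD; congr (_ - #|pred_of_set _|)%N; apply/setP => j; rewrite !inE.
  by rewrite andb_idl //; apply: BA.
rewrite -prodr_const; apply: eq_big => j; first by rewrite !inE andbC.
by case/andP=> _ /negPf->.
Qed.

Lemma prod_value_weight t :
  \prod_q value_weight q t = y ^+ erec t * v ^+ (exc t - erec t).
Proof.
rewrite -(prod_two_weights (A := is_exc t) (B := is_erec t)) => [|j]; last first.
  by rewrite erecE => /andP[].
rewrite (reindex_inj (@perm_inj _ t)) /=; apply: eq_bigr => j _.
by rewrite /value_weight permK erecE /is_exc; case: ifP.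
Qed.

Lemma prod_position_weight t : (forall i, spec i t -> (t i <= i)%N) ->
  \prod_i position_weight i t =
  x ^+ #|[set i | spec i t]| * u ^+ (n - exc t - #|[set i | spec i t]|).
Proof.
move=> le; rewrite (prod_two_weights (A := fun i => (t i < i.+1)%N)) //.
congr (_ * _ ^+ (_ - _)); apply: (@addnI (exc t)); rewrite subnKC; last first.
  by rewrite -[X in (_ <= X)%N](card_ord n) max_card.
rewrite -[RHS](card_ord n) -(cardsC [set j | is_exc t j]); congr (_ + _)%N.
by apply: eq_card => j; rewrite !inE /is_exc -leqNgt.
Qed.

Lemma sum_statistics_Dyck : (forall i t, spec i t -> (t i <= i)%N) ->
  \sum_(t : 'S_n) x ^+ #|[set i | spec i t]| * y ^+ erec t *
     u ^+ (n - exc t - #|[set i | spec i t]|) * v ^+ (exc t - erec t) =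
  Dyck a n.*2 0.
Proof.
move=> le; rewrite -sum_weights_Dyck; apply: eq_bigr => t _.
rewrite big_split /= prod_value_weight prod_position_weight; last exact: (le^~ t).
by rewrite [RHS]mulrC [RHS]mulrACA [RHS]mulrA.
Qed.

End Weights.

End Sweep.

Theorem theorem2p1 (alpha P : nat -> {mpoly int[4]}) :
  let x : {mpoly int[4]} := 'X_(@Ordinal 4 0 isT) in
  let y : {mpoly int[4]} := 'X_(@Ordinal 4 1 isT) in
  let u : {mpoly int[4]} := 'X_(@Ordinal 4 2 isT) in
  let v : {mpoly int[4]} := 'X_(@Ordinal 4 3 isT) in
  (forall k : nat, (1 <= k)%N -> alpha (2 * k - 1)%N = x + (k - 1)%:R * u) ->
  (forall k : nat, (1 <= k)%N -> alpha (2 * k)%N = y + (k - 1)%:R * v) ->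
  is_Sfrac alpha P ->
  forall n : nat,
    P n = \sum_(s : 'S_n) x ^+ arec s * y ^+ erec s
            * u ^+ (n - exc s - arec s)%N * v ^+ (exc s - erec s)%N
    /\
    P n = \sum_(s : 'S_n) x ^+ cyc s * y ^+ erec s
            * u ^+ (n - exc s - cyc s)%N * v ^+ (exc s - erec s)%N.
Proof.
move=> x y u v alpha_odd alpha_even PS n; rewrite (is_Sfrac_Dyck n PS).
have a_odd k : alpha k.*2.+1 = x + k%:R * u.
  by have := alpha_odd k.+1 isT; rewrite mul2n subSS subn0 doubleS !subSS subn0.
have a_even k : alpha k.*2.+2 = y + k%:R * v.
  by have := alpha_even k.+1 isT; rewrite mul2n subSS subn0 doubleS.
split; symmetry.
  apply: (sum_statistics_Dyck a_odd a_even (spec := fun i s => is_arec s i)).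
    exact: arec_special.
  by move=> i t; apply: arec_le.
under eq_bigr => s _ do rewrite -card_cycmax.
apply: (sum_statistics_Dyck a_odd a_even (spec := @cycmax n)).
  move=> i s _; have [d dO dE] := cycmax_special i s; exists d => // t st ti.
  by rewrite cycmaxV dE.
by move=> i t /forall_inP; apply; have := mem_porbit t 1 i; rewrite expg1.
Qed.
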